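(* $c_3<1$, where $$c_3:=\sup\left(\left\{\frac{|X_{3,\phi}(H)|}{|H|} : H \text{ a finite group},\ \phi\in \mathrm{Aut}(H),\ \phi^3=\mathrm{id}\right\}\setminus\{1\}\right).$$
   Context: For a group $H$ and an automorphism $\phi$ of $H$ with $\phi^3=\mathrm{id}$, writing $x^\phi$ for the image of $x$, $X_{3,\phi}(H):=\{x\in H : x x^{\phi} x^{\phi^2}=1\}$. *)

(* Defs.v *)
From mathcomp Require Import all_boot all_order all_algebra all_fingroup.
Set Implicit Arguments. Unset Strict Implicit. Unset Printing Implicit Defensive.

(* A finite group H is represented by a finGroupType gT (H = [set: gT]);
   an automorphism of H is a permutation phi of gT lying in Aut [set: gT]. *)

Definition X3 (gT : finGroupType) (phi : {perm gT}) : {set gT} :=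
  [set x : gT | (x * phi x * phi (phi x) == 1)%g].

Definition X3ratio (gT : finGroupType) (phi : {perm gT}) : rat :=
  (#|X3 phi|%:R / #|[set: gT]|%:R)%R.

(* Main.v *)
(** Embed [H] in its permutation group by right translations; the condition
    [x x^phi x^(phi^2) = 1] then says that the element [x phi^-1] of the coset
    [T = H phi^-1] has trivial cube.  Suppose that all but a small proportion of
    the elements of [T] do.

    For fixed [h] in [H] and generic [t] in [T], the elements [t], [t h] and
    [t h^-1] all have trivial cube, which forces [h], [h^t], [h^(t^-1)] to commute
    and to have product 1.  Written additively, with [t] acting as an operator,
    this is [1 + t + t^-1 = 0].  For generic [x] in [H], with [X = x - 1], it
    follows that [t X = X t^-1]; comparing this for [x], [y] and [x y] yields
    [X Y t = X Y], so [[h, x, y]] commutes with generic, hence with all, [t].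
    Since a subgroup containing more than half of a group is the whole group, [H]
    is nilpotent of class at most 3, exactly and not just generically.

    Now [[h, x, y, z] = 1] expresses [h] as an alternating product of the
    conjugates [h^w] with [w] in [{x, y, z, xy, xz, yz, xyz}]; choosing all seven
    words generic transfers the generic relations to all elements of [H] and
    [T], and then every cube in [T] is trivial. *)

Require Import Defs.
From mathcomp Require Import all_boot all_order all_algebra all_fingroup.
From mathcomp Require Import cyclic commutator center nilpotent zify.
Import Order.TTheory GRing.Theory Num.Theory.
Import GroupScope.

Set Implicit Arguments.
Unset Strict Implicit.
Unset Printing Implicit Defensive.

(** * Counting failures over a finite set *)

Section SumBounds.

(** Serves union bounds: an injective change of variable cannot raise the number of failures. *)
Lemma leq_sum_inj (S U : finType) (A : {set S}) (B : {set U}) (f : S -> U)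
    (F : U -> nat) :
    {in A &, injective f} -> {in A, forall x, f x \in B} ->
  \sum_(x in A) F (f x) <= \sum_(y in B) F y.
Proof.
move=> f_inj fAB; rewrite -(big_imset F f_inj) /=.
rewrite [leqRHS](big_setID (f @: A)) /=.
have /setIidPr -> : f @: A \subset B by apply/subsetP=> _ /imsetP[x Ax ->]; exact: fAB.
exact: leq_addr.
Qed.

Lemma ex_sum_eq0 (S : finType) (A : {set S}) (F : S -> nat) :
  \sum_(x in A) F x < #|A| -> exists2 x, x \in A & F x = 0.
Proof.
case: (pickP [pred x in A | F x == 0]) => [x /andP[Ax /eqP]|F_neq0]; first by exists x.
rewrite ltnNge => /negP[]; rewrite -sum1_card; apply: leq_sum => x Ax.
by rewrite lt0n; have:= F_neq0 x; rewrite /= Ax /= => ->.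
Qed.

Lemma leq_sum_const (S : finType) (A : {set S}) (F : S -> nat) (m : nat) :
  {in A, forall x, F x <= m} -> \sum_(x in A) F x <= #|A| * m.
Proof. by move=> leFm; rewrite -sum_nat_const; apply: leq_sum. Qed.

End SumBounds.

(** * Pointwise relations forced by trivial cubes *)

Section CubesInCoset.

Context {gT : finGroupType}.
Implicit Types (h x y z t s u v w g : gT).

Definition cube_pair h t := [&& t ^+ 3 == 1, (t * h) ^+ 3 == 1 & (t * h^-1) ^+ 3 == 1].

Lemma expg3E t : t ^+ 3 = t * t * t.
Proof. by rewrite !expgSr expg0 mul1g. Qed.

Lemma commuteJ g x y : commute (x ^ g) (y ^ g) <-> commute x y.
Proof. by rewrite /commute -!conjMg; split=> [/conjg_inj|->]. Qed.

Lemma commuteJV g x : commute x (x ^ g) -> commute x (x ^ g^-1).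
Proof. by move/(commuteJ g^-1); rewrite conjgK => /commute_sym. Qed.

Lemma conjM3g x y z g : (x * y * z) ^ g = x ^ g * y ^ g * z ^ g.
Proof. by rewrite !conjMg. Qed.

Lemma cube_mulg_conj t h : t ^+ 3 = 1 -> (t * h) ^+ 3 = h ^ t^-1 * h ^ t * h.
Proof.
move=> t3; have tV : t^-1 = t * t by apply: (mulgI t); rewrite mulgV mulgA -expg3E.
rewrite expg3E /conjg invgK !mulgA; congr (_ * _ * _ * _).
by rewrite -[RHS]mulgA -invMg -tV invgK.
Qed.

(** The two shifted cubes give [h ^ t^-1 * h ^ t * h = 1] and, after inversion,
    [h * h ^ t * h ^ t^-1 = 1]. Comparing the two orders makes [h] and [h ^ t] commute. *)
Lemma cube_pairP h t : cube_pair h t ->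
  [/\ t ^+ 3 = 1, commute h (h ^ t), commute h (h ^ t^-1)
    & h * h ^ t * h ^ t^-1 = 1].
Proof.
case/and3P=> /eqP t3 /eqP th3 /eqP thV3.
rewrite !cube_mulg_conj // in th3 thV3.
have prod1 : h * h ^ t * h ^ t^-1 = 1.
  by apply: invg_inj; rewrite invMg -conjVg invMg -conjVg mulgA invg1.
have hht : commute h (h ^ t).
  apply: (mulIg (h ^ t^-1)); rewrite prod1.
  suff -> : h ^ t * h = (h ^ t^-1)^-1 by rewrite mulVg.
  by apply: (mulgI (h ^ t^-1)); rewrite mulgA th3 mulgV.
split=> //; exact: commuteJV.
Qed.

(* With [s = x^-1 * t], the relations between [h], [t] and [s] that yield
   [t X = X t^-1] on [h], where [X = x - 1]. *)
Definition cube_quintuple h x t :=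
  [&& cube_pair h t, cube_pair h (x^-1 * t), cube_pair h (t * x^-1 * t)^-1,
      cube_pair (h ^ t) (x^-1 * t) & cube_pair (h ^ x) t].

(** In additive notation, with [q], [r], [m] the conjugates of [h] by [t], [s], [x], both sides of
    the first commutator identity reduce to [h - q - m + r], and those of the second to [q - r]. The
    commuting pairs justify the reorderings. *)
Lemma cube_quintupleP h x t : cube_quintuple h x t ->
  [/\ t ^+ 3 = 1, commute h (h ^ x), [~ h ^ t, x] = [~ h, x] ^ t^-1
    & [~ h ^ t^-1, x] = [~ h, x] ^ t].
Proof.
have [s sE] : exists s, s = x^-1 * t by exists (x^-1 * t).
have ts : t * x^-1 * t = t * s by rewrite sE mulgA.
rewrite /cube_quintuple -sE => /and5P[Et Es Ets Ehs Ext].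
rewrite ts in Ets.
have {Et} [t3 pq pt pqE] := cube_pairP Et.
have {Es} [_ pr _ prE] := cube_pairP Es.
have {Ets} [ts3 _ pts ptsE] := cube_pairP Ets; rewrite invgK in pts ptsE.
have {Ehs} [_ _ _ qsE] := cube_pairP Ehs.
have {Ext} [_ mt _ mtE] := cube_pairP Ext.
have tt : t * t = t^-1 by apply: (mulgI t); rewrite mulgV mulgA -expg3E.
have tst : (t * s)^-1 * s^-1 = t * s * t.
  apply: (mulIg s); rewrite mulgKV; apply: (mulgI (t * s)).
  rewrite mulgV !mulgA; apply: invg_inj.
  by rewrite invg1 -ts3 expg3E -!invMg !mulgA.
have sV : t^-1 * x = s^-1 by rewrite sE invMg invgK.
have xE : t * s^-1 = x by rewrite sE invMg invgK mulKVg.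
set q := h ^ t in pq pqE qsE *.
set r := h ^ s in pr prE; set m := h ^ x in mt mtE.
have htV : h ^ t^-1 = (h * q)^-1 by apply: (mulgI (h * q)); rewrite mulgV.
have hsV : h ^ s^-1 = (h * r)^-1 by apply: (mulgI (h * r)); rewrite mulgV.
have q_pr : commute q (h * r).
  have /(commuteJ s^-1) := pts.
  by rewrite hsV -conjgM mulgK -/q => /commute_sym/commuteV; rewrite invgK.
have qr : commute q r.
  rewrite -[r](mulKg h); apply: commuteM => //.
  by apply/commuteV/commute_sym.
have hts : h ^ (t * s * t) = h * r * q^-1.
  have /= := congr1 (conjg^~ s^-1) ptsE.
  rewrite conjM3g conj1g -!conjgM tst mulgK hsV -/q => eq1.
  by apply: (mulgI (h * r)^-1); apply: (mulIg q); rewrite eq1 mulKg mulVg.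
have hxt : h ^ (x * t) = q * r^-1 * q.
  have /= := congr1 (conjg^~ t) qsE; rewrite conjM3g conj1g /q -!conjgM !(mulgA t) xE hts tt htV.
  move=> eq1; apply: (mulgI ((h * q)^-1 * (h * r * q^-1))); rewrite eq1.
  have cancel (a b c : gT) : (a * b)^-1 * (a * c * b^-1) * (b * c^-1 * b) = 1.
    by rewrite invMg !mulgA !mulgKV mulgK mulVg.
  by rewrite cancel.
have pqr : h * q * (h * r)^-1 = r^-1 * q.
  by rewrite pr invMg mulgA pq mulgK; apply: commuteV.
have m_pr : commute m (h * r).
  have /(commuteJ x) := pt.
  by rewrite -conjgM sV hsV => /commuteV; rewrite invgK.
have htx : h ^ (t * x) = m^-1 * (h * r).
  have /= := congr1 (conjg^~ x) pqE; rewrite conjM3g conj1g -!conjgM sV hsV -/m.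
  by move=> eq1; apply: (mulgI m); apply: (mulIg (h * r)^-1); rewrite eq1 mulKVg mulgV.
have mtV : m ^ t^-1 = (m * m ^ t)^-1 by apply: (mulgI (m * m ^ t)); rewrite mulgV.
split=> //.
(* This is [qr], read as the conjugate by [t] of the commutation of [h] with [h ^ x^-1]. *)
- have /(commuteJ t)/commuteJV : commute (h ^ t) ((h ^ x^-1) ^ t) by rewrite -conjgM -sE.
  by rewrite invgK.
- rewrite !commgEl [RHS]conjMg conjVg htV invgK -/m mtV -(conjgM h t x) htx -/q.
  rewrite {2}/m -conjgM hxt -/m.
  have mV : m^-1 * (h * r) = h * r * m^-1 by apply/commute_sym/commuteV/commute_sym.
  have qV : q^-1 * (h * r) = h * r * q^-1 by apply/commute_sym/commuteV/commute_sym.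
  have cancel (a b c d : gT) : a * b * (d * (b * c^-1 * b))^-1 = a * c * b^-1 * d^-1.
    by rewrite !invMg invgK !mulgA mulgK.
  by rewrite mV (mulgA q^-1) qV cancel.
- rewrite !commgEl -conjgM sV hsV htV invgK [RHS]conjMg conjVg -/q -conjgM hxt.
  by rewrite pqr -(mulgA q) mulKg.
Qed.

Lemma commg3E h x y : [~ h, x, y] = [~ h, x]^-1 * [~ h, y]^-1 * [~ h, x * y].
Proof.
have cancel (a b c : gT) : (a * b)^-1 * (a * c) = b^-1 * c.
  by rewrite invMg -mulgA mulKg.
rewrite -mulgA [LHS]commgEl; congr (_ * _).
by rewrite !commgEl cancel conjMg conjVg -conjgM.
Qed.

(** [[~ h ^ t, x, y]] is computed twice: moving [t] past [x] and then [y] gives [[~ h, x, y] ^ t],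
    while expanding by [commg3E] gives [[~ h, x, y] ^ t^-1]. So [t ^+ 2] fixes [[~ h, x, y]], and
    hence so does [t], as [t ^+ 3 = 1]. *)
Lemma cube_commg3 h x y t :
    cube_quintuple h x t -> cube_quintuple h y t -> cube_quintuple h (x * y) t ->
    cube_quintuple [~ h, x] y t ->
  commute [~ h, x, y] t.
Proof.
case/cube_quintupleP=> t3 _ Ex _ /cube_quintupleP[_ _ Ey _].
case/cube_quintupleP=> _ _ Exy _ /cube_quintupleP[_ _ _ Ec].
have: [~ h, x, y] ^ t = [~ h, x, y] ^ t^-1.
  by rewrite -Ec -Ex !commg3E Ex Ey Exy -!conjVg -!conjMg.
move/(congr1 (conjg^~ t)); rewrite conjgKV -conjgM => c_tt.
by rewrite /commute conjgC -{1}c_tt -conjgM -expg3E t3 conjg1.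
Qed.

(** * Counting failures in the coset [T] *)

Variables (H : {group gT}) (a : gT).
Hypotheses (nHa : a \in 'N(H)) (a3 : a ^+ 3 = 1).

Let T : {set gT} := H :* a.
Let n := #|H|.
Let bad := \sum_(t in T) (t ^+ 3 != 1)%g.

Lemma coset_norm t : t \in T -> t \in 'N(H).
Proof. by case/rcosetP=> h Hh ->; rewrite groupM // (subsetP (normG H)). Qed.

Lemma coset_mull h t : h \in H -> t \in T -> h * t \in T.
Proof. by move=> Hh /rcosetP[k Hk ->]; rewrite mulgA mem_rcoset mulgK groupM. Qed.

Lemma coset_conj h t : h \in H -> t \in T -> h ^ t \in H.
Proof. by move=> Hh /coset_norm/memJ_norm ->. Qed.

Lemma coset_conjV h t : h \in H -> t \in T -> h ^ t^-1 \in H.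
Proof. by move=> Hh /coset_norm tN; rewrite memJ_norm ?groupV. Qed.

Lemma coset_mulr h t : h \in H -> t \in T -> t * h \in T.
Proof. by move=> Hh Tt; rewrite conjgCV coset_mull ?coset_conjV. Qed.

Lemma coset_div t s : t \in T -> s \in T -> t * s^-1 \in H.
Proof.
case/rcosetP=> h Hh -> /rcosetP[k Hk ->].
by rewrite invMg mulgA mulgK groupM ?groupV.
Qed.

Lemma coset_mulV t s : t \in T -> s \in T -> (t * s)^-1 \in T.
Proof.
case/rcosetP=> h Hh -> /rcosetP[k Hk ->]; rewrite mem_rcoset -invMg groupV.
have -> : a * (h * a * (k * a)) = h ^ a^-1 * k ^ (a * a)^-1.
  rewrite !mulgA (conjgCV a h) -!mulgA; congr (_ * _).
  by rewrite (mulgA a a) (mulgA (a * a)) (conjgCV (a * a)) -mulgA -expg3E a3 mulg1.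
by rewrite groupM // memJ_norm // groupV // groupM.
Qed.

Lemma card_coset : #|T| = n.
Proof. exact: card_rcoset. Qed.

Lemma sum_cube_pair h : h \in H -> (\sum_(t in T) ~~ cube_pair h t <= 3 * bad)%N.
Proof.
move=> Hh; apply: (@leq_trans (\sum_(t in T)
  ((t ^+ 3 != 1)%g + ((t * h) ^+ 3 != 1)%g + ((t * h^-1) ^+ 3 != 1)%g)%N)).
  by apply: leq_sum => t _; rewrite /cube_pair; do 3!case: (_ == _).
rewrite !big_split /= !mulSn mul0n addn0 addnA.
rewrite !leq_add //; apply: leq_sum_inj => [t s _ _ /mulIg // | t Tt];
  by rewrite coset_mulr ?groupV.
Qed.

Lemma sum_cube_quintuple h : h \in H ->
  (\sum_(x in H) \sum_(t in T) ~~ cube_quintuple h x t <= n * (15 * bad))%N.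
Proof.
move=> Hh; apply: (@leq_trans (\sum_(x in H) \sum_(t in T)
  (~~ cube_pair h t + ~~ cube_pair h (x^-1 * t)
   + ~~ cube_pair h (t * x^-1 * t)^-1 + ~~ cube_pair (h ^ t) (x^-1 * t)
   + ~~ cube_pair (h ^ x) t)%N)).
  apply: leq_sum => x _; apply: leq_sum => t _; rewrite /cube_quintuple.
  by do 5!case: (cube_pair _ _).
have -> : (n * (15 * bad) = n * (3 * bad) + n * (3 * bad) + n * (3 * bad)
           + n * (3 * bad) + n * (3 * bad))%N by lia.
under eq_bigr do rewrite !big_split /=; rewrite !big_split /=.
have injT t : injective (fun x => x^-1 * t) by move=> x y /mulIg/invg_inj.
rewrite !leq_add //.
- by apply: leq_sum_const => x _; exact: sum_cube_pair.
- apply: leq_sum_const => x Hx; apply: leq_trans (sum_cube_pair Hh).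
  apply: (@leq_sum_inj _ _ T T (mulg x^-1) (fun t => ~~ cube_pair h t : nat)).
    by move=> t s _ _ /mulgI.
  by move=> t Tt; rewrite coset_mull ?groupV.
(* Here and in the next case [t] is fixed and [x] varies: [t * x^-1 * t] is injective in [x], and
   [h ^ t] must stay constant. *)
- rewrite exchange_big /= -card_coset; apply: leq_sum_const => t Tt.
  apply: leq_trans (sum_cube_pair Hh).
  apply: (@leq_sum_inj _ _ H T (fun x => (t * x^-1 * t)^-1)
            (fun t => ~~ cube_pair h t : nat)).
    by move=> x y _ _ /invg_inj/mulIg/mulgI/invg_inj.
  by move=> x Hx; rewrite coset_mulV ?coset_mulr ?groupV.
- rewrite exchange_big /= -card_coset; apply: leq_sum_const => t Tt.
  apply: leq_trans (sum_cube_pair (coset_conj Hh Tt)).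
  apply: (@leq_sum_inj _ _ H T (fun x => x^-1 * t)
            (fun s => ~~ cube_pair (h ^ t) s : nat)); first by move=> x y _ _ /injT.
  by move=> x Hx; rewrite coset_mull ?groupV.
- by apply: leq_sum_const => x Hx; apply: sum_cube_pair; rewrite groupJ.
Qed.

Lemma sum_commg3 h : h \in H ->
  (\sum_(x in H) \sum_(y in H) \sum_(t in T) ([~ h, x, y] \notin 'C[t])
     <= n * (n * (60 * bad)))%N.
Proof.
move=> Hh; apply: (@leq_trans (\sum_(x in H) \sum_(y in H) \sum_(t in T)
  (~~ cube_quintuple h x t + ~~ cube_quintuple h y t
   + ~~ cube_quintuple h (x * y)%g t + ~~ cube_quintuple [~ h, x] y t)%N)).
  apply: leq_sum => x _; apply: leq_sum => y _; apply: leq_sum => t _.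
  have [// | cC] := boolP (_ \in 'C[t]); rewrite lt0n -!addnA !addn_eq0 !eqb0 !negbK.
  by apply: contra cC => /and4P[*]; apply/cent1P; exact: cube_commg3.
have -> : (n * (n * (60 * bad)) = n * (n * (15 * bad)) + n * (n * (15 * bad))
            + n * (n * (15 * bad)) + n * (n * (15 * bad)))%N by lia.
under eq_bigr do under eq_bigr do rewrite !big_split /=.
under eq_bigr do rewrite !big_split /=.
rewrite !big_split /= !leq_add //.
- by rewrite exchange_big; apply: leq_sum_const => y _; exact: sum_cube_quintuple.
- by apply: leq_sum_const => x _; exact: sum_cube_quintuple.
- apply: leq_sum_const => x Hx; apply: leq_trans (sum_cube_quintuple Hh).
  apply: (@leq_sum_inj _ _ H H (mulg x)
            (fun y => \sum_(t in T) ~~ cube_quintuple h y t)%N).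
    by move=> y z _ _ /mulgI.
  by move=> y Hy; rewrite groupM.
- by apply: leq_sum_const => x Hx; apply: sum_cube_quintuple; rewrite groupR.
Qed.

(** * From most elements to all: nilpotency of class at most 3 *)

Lemma sub_of_most (K : {group gT}) :
  (2 * \sum_(x in H) (x \notin K) < n)%N -> H \subset K.
Proof.
have -> : (\sum_(x in H) (x \notin K) = #|H :\: K|)%N.
  rewrite -sum1_card (big_setID K) /= big1 => [|x /setIP[_ ->] //].
  by rewrite add0n; apply: eq_bigr => x /setDP[_ ->].
apply: contraLR; rewrite -leqNgt -indexg_gt1 -indexgI => i_gt1.
have := leq_mul (leqnn #|H :&: K|) i_gt1; rewrite Lagrange ?subsetIl //.
by have := cardsID K H; rewrite -/n; lia.
Qed.

(** Fix one [t0] in [T] commuting with [c]: then [x * t0] commutes with [c] exactly when [x] does,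
    so [c] commutes with most of [H]. *)
Lemma cent_of_most_coset c : c \in H ->
  (2 * \sum_(t in T) (c \notin 'C[t]) < n)%N -> c \in 'Z(H).
Proof.
move=> Hc lt_n; rewrite inE Hc /= -sub_cent1; apply: sub_of_most.
have [t0 Tt0 /eqP] : exists2 t0, t0 \in T & (c \notin 'C[t0]) = 0 :> nat.
  by apply: ex_sum_eq0; rewrite card_coset; lia.
rewrite eqb0 negbK => /cent1P ct0.
apply: leq_ltn_trans lt_n; rewrite leq_mul2l /=.
apply: (@leq_trans (\sum_(x in H) (c \notin 'C[x * t0]))%N).
  apply: leq_sum => x _; have [xC | _] := boolP (c \in 'C[x * t0]); last exact: leq_b1.
  rewrite -(mulgK t0 x) groupM ?groupV ?[x * t0 \in _]cent1C // cent1C.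
  by apply/cent1P.
apply: (@leq_sum_inj _ _ H T (fun x => x * t0) (fun t => (c \notin 'C[t]) : nat)).
  by move=> x y _ _ /mulIg.
by move=> x Hx; exact: coset_mull.
Qed.

(** As [H] normalises [N], the [y] with [[~ g, y]] in [N] form a subgroup, by the expansion of
    [[~ g, y * z]]. *)
Lemma commg_of_most (N : {group gT}) g : H \subset 'N(N) ->
    (2 * \sum_(y in H) ([~ g, y] \notin N) < n)%N ->
  {in H, forall y, [~ g, y] \in N}.
Proof.
move=> nNH lt_n; pose K := [set y in H | [~ g, y] \in N].
have gK : group_set K.
  apply/group_setP; split=> [|y z]; first by rewrite inE group1 commg1 group1.
  rewrite !inE => /andP[Hy Ny] /andP[Hz Nz].
  by rewrite groupM //= commgMJ groupM // memJ_norm // (subsetP nNH).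
suff /subsetP sHK : H \subset Group gK by move=> y /sHK; rewrite inE => /andP[].
apply: sub_of_most; apply: leq_ltn_trans lt_n; rewrite leq_mul2l /=.
by apply: leq_sum => y Hy; rewrite inE Hy.
Qed.

Lemma mem_ucn2 g : g \in H -> {in H, forall y, [~ g, y] \in 'Z(H)} -> g \in 'Z_2(H).
Proof.
move=> Hg gZ; rewrite ucnSnR inE Hg ucn1 gen_subG.
by apply/subsetP=> _ /imset2P[_ y /set1P-> Hy ->]; exact: gZ.
Qed.

Lemma commg4_eq1 h x y z : (480 * bad < n)%N ->
  h \in H -> x \in H -> y \in H -> z \in H -> [~ h, x, y, z] = 1.
Proof.
move=> lt_n Hh Hx Hy Hz; have n_gt0 : (0 < n)%N by exact: cardG_gt0.
have nZH m : H \subset 'N('Z_m(H)) by rewrite normal_norm ?ucn_normal.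
(* A commutator outside the centre fails to commute with at least half of [T]. Each passage from
   most to all thus doubles the constant: 60, 120, 240, 480. *)
have sum2 : (\sum_(x in H) \sum_(y in H) ([~ h, x, y] \notin 'Z(H))
               <= n * (120 * bad))%N.
  rewrite -(leq_pmul2l n_gt0) big_distrr /=.
  have -> : (n * (n * (120 * bad)) = 2 * (n * (n * (60 * bad))))%N by lia.
  apply: leq_trans (leq_mul (leqnn 2) (sum_commg3 Hh)).
  rewrite big_distrr /=; apply: leq_sum => u Hu.
  rewrite !big_distrr /=; apply: leq_sum => v Hv.
  have [_ | cZ] := boolP (_ \in 'Z(H)); first by rewrite muln0.
  rewrite muln1 leqNgt; apply: contra cZ => lt_t.
  by apply: cent_of_most_coset lt_t; rewrite !groupR.
have sum1 : (\sum_(x in H) ([~ h, x] \notin 'Z_2(H)) <= 240 * bad)%N.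
  rewrite -(leq_pmul2l n_gt0) big_distrr /=.
  have -> : (n * (240 * bad) = 2 * (n * (120 * bad)))%N by lia.
  apply: leq_trans (leq_mul (leqnn 2) sum2).
  rewrite big_distrr /=; apply: leq_sum => u Hu.
  have [_ | cZ] := boolP (_ \in 'Z_2(H)); first by rewrite muln0.
  rewrite muln1 leqNgt; apply: contra cZ => lt_u.
  apply: mem_ucn2; first by rewrite groupR.
  by apply: commg_of_most lt_u; rewrite normal_norm ?center_normal.
have hxZ2 : [~ h, x] \in 'Z_2(H).
  apply: (commg_of_most (nZH 2)) Hx.
  by apply: leq_ltn_trans (leq_mul (leqnn 2) sum1) _; lia.
have : [~ h, x, y] \in 'Z(H).
  by rewrite -ucn1 (subsetP (ucn_comm 1 H)) ?mem_commg.
by case/setIP=> _ /centP/(_ z Hz) cz; apply/eqP/commgP.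
Qed.

(** * Transfer from generic words to all elements *)

(** Expand the equality of [[~ h, x, y]] with its conjugate by [z] and solve for the bare [h]; this
    order of the factors is valid without commutativity. *)
Lemma conj_alternating h x y z : [~ h, x, y, z] = 1 ->
  h = h ^ x * (h ^ (x * z))^-1 * h ^ z * (h ^ (y * z))^-1 * h ^ (x * y * z)
        * (h ^ (x * y))^-1 * h ^ y.
Proof.
move/eqP/conjg_fixP.
have -> : [~ h, x, y] = (h ^ x)^-1 * h * ((h ^ y)^-1 * h ^ (x * y)).
  have invMV (u v : gT) : (u^-1 * v)^-1 = v^-1 * u by rewrite invMg invgK.
  by rewrite !commgEl invMV [in LHS]conjMg conjVg -conjgM.
rewrite [LHS]conjMg conjMg conjVg [(_^-1 * h ^ _) ^ z]conjMg conjVg -!conjgM.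
have solve (u v w p q r s : gT) : p^-1 * q * (r^-1 * s) = u^-1 * h * (v^-1 * w) ->
    h = u * p^-1 * q * r^-1 * s * w^-1 * v.
  move=> eqh; apply: (mulIg (v^-1 * w)); apply: (mulgI u^-1).
  by rewrite (mulgA u^-1 h) -eqh !mulgA mulVg mul1g mulgK mulgKV.
exact: solve.
Qed.

Lemma conj_alternatingJ h x y z g : [~ h, x, y, z] = 1 ->
  h ^ g = h ^ (x * g) * (h ^ (x * z * g))^-1 * h ^ (z * g) * (h ^ (y * z * g))^-1
            * h ^ (x * y * z * g) * (h ^ (x * y * g))^-1 * h ^ (y * g).
Proof.
have conjM7 (u1 u2 u3 u4 u5 u6 u7 : gT) :
    (u1 * u2^-1 * u3 * u4^-1 * u5 * u6^-1 * u7) ^ g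
      = u1 ^ g * (u2 ^ g)^-1 * u3 ^ g * (u4 ^ g)^-1 * u5 ^ g * (u6 ^ g)^-1 * u7 ^ g.
  by rewrite !conjMg !conjVg.
by move/conj_alternating/(congr1 (conjg^~ g)) => /= ->; rewrite conjM7 -!conjgM.
Qed.

(** Greedy choice: [x], [y], [z] in turn face one, two and four conditions, each a left translate of
    [P]. *)
Lemma ex_good_words (P : pred gT) : (7 * \sum_(w in H) ~~ P w < n)%N ->
  exists x y z, [/\ [/\ x \in H, y \in H & z \in H], [/\ P x, P y & P z],
    [/\ P (x * y), P (x * z) & P (y * z)] & P (x * y * z)].
Proof.
set b := (\sum_(w in H) _)%N => lt_n.
have shift u : u \in H -> (\sum_(w in H) ~~ P (u * w)%g <= b)%N.
  move=> Hu; apply: (@leq_sum_inj _ _ H H (mulg u) (fun w => ~~ P w : nat)).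
    by move=> y z _ _ /mulgI.
  by move=> w Hw; rewrite groupM.
have [x Hx /eqP] : exists2 x, x \in H & ~~ P x = 0 :> nat.
  by apply: ex_sum_eq0; rewrite -/b -/n; lia.
rewrite eqb0 negbK => Px.
have [y Hy /eqP] : exists2 y, y \in H & (~~ P y + ~~ P (x * y)%g)%N = 0.
  apply: ex_sum_eq0; rewrite big_split /= -/n.
  by apply: leq_ltn_trans (leq_add (leqnn b) (shift x Hx)) _; lia.
rewrite addn_eq0 !eqb0 !negbK => /andP[Py Pxy].
have [z Hz /eqP] : exists2 z, z \in H &
    (~~ P z + ~~ P (x * z)%g + (~~ P (y * z)%g + ~~ P (x * y * z)%g))%N = 0.
  apply: ex_sum_eq0; rewrite !big_split /= -/n.
  apply: leq_ltn_trans (leq_add (leq_add (leqnn b) (shift _ Hx))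
    (leq_add (shift _ Hy) (shift _ (groupM Hx Hy)))) _.
  by lia.
rewrite !addn_eq0 !eqb0 !negbK => /andP[/andP[Pz Pxz] /andP[Pyz Pxyz]].
by exists x, y, z.
Qed.

(** A round constant above those required below: 480 for nilpotency, 7 * 15 and 7 * 3 for the
    transfers. *)
Hypothesis lt_bad : (1000 * bad < n)%N.

Let commg4 h x y z :
  h \in H -> x \in H -> y \in H -> z \in H -> [~ h, x, y, z] = 1.
Proof. by apply: commg4_eq1; lia. Qed.

Lemma commute_of_most_conj g h : h \in H ->
  (7 * \sum_(w in H) (h ^ w \notin 'C[g])%g < n)%N -> h \in 'C[g].
Proof.
move=> Hh /(@ex_good_words (fun w => h ^ w \in 'C[g])).
move=> [x [y [z [[Hx Hy Hz] [Cx Cy Cz] [Cxy Cxz Cyz] Cxyz]]]].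
by rewrite (conj_alternating (commg4 Hh Hx Hy Hz)); do 6!rewrite groupM ?groupV //.
Qed.

Lemma sum_commute_conj h : h \in H ->
  (\sum_(x in H) (h ^ x \notin 'C[h])%g <= 15 * bad)%N.
Proof.
move=> Hh; have n_gt0 : (0 < n)%N by exact: cardG_gt0.
rewrite -(leq_pmul2l n_gt0); apply: leq_trans (sum_cube_quintuple Hh).
rewrite big_distrr; apply: leq_sum => x Hx /=.
have [_ | xC] := boolP (_ \in _); first by rewrite muln0.
rewrite -card_coset -sum_nat_const; apply: leq_sum => t _.
rewrite lt0b; apply: contra xC => /cube_quintupleP[_ hx _ _]; exact/cent1P.
Qed.

Lemma commute_conj_sub h k : h \in H -> k \in H -> commute h (h ^ k).
Proof.
move=> Hh Hk; apply/cent1P; apply: commute_of_most_conj => //.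
apply: (@leq_ltn_trans (7 * (15 * bad))); last by lia.
rewrite leq_mul2l /=; apply: leq_trans (sum_commute_conj Hh).
(* Conjugation by [k] turns commutation of [h ^ (w * k^-1)] with [h] into that of [h ^ w] with
   [h ^ k]. *)
apply: (@leq_trans (\sum_(w in H) (h ^ (w * k^-1) \notin 'C[h])%g)%N).
  apply: leq_sum => w Hw; case: (boolP (h ^ (w * k^-1) \in _)) => [|_].
    by move/cent1P/(commuteJ k); rewrite -conjgM mulgKV => /cent1P ->.
  exact: leq_b1.
apply: (@leq_sum_inj _ _ H H (fun w => w * k^-1) (fun w => (h ^ w \notin 'C[h]) : nat)).
  by move=> y z _ _ /mulIg.
by move=> w Hw; rewrite groupM ?groupV.
Qed.

(** The transfer is applied to [h ^ t]: its conjugate by a generic [w] is [h ^ (t * w)], with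
    [t * w] generic in [T]. *)
Lemma commute_conj_coset h t : h \in H -> t \in T -> commute h (h ^ t).
Proof.
move=> Hh Tt; apply/commute_sym/cent1P; apply: commute_of_most_conj.
  exact: coset_conj.
apply: (@leq_ltn_trans (7 * (3 * bad))); last by lia.
rewrite leq_mul2l /=; apply: leq_trans (sum_cube_pair Hh).
apply: (@leq_trans (\sum_(w in H) ~~ cube_pair h (t * w)%g)%N).
  apply: leq_sum => w Hw; case: (boolP (cube_pair _ _)) => [/cube_pairP[_ hw _ _]|_].
    by rewrite -conjgM; move/cent1P: (commute_sym hw) => ->.
  exact: leq_b1.
apply: (@leq_sum_inj _ _ H T (mulg t) (fun w => ~~ cube_pair h w : nat)).
  by move=> y z _ _ /mulgI.
by move=> w Hw; exact: coset_mulr.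
Qed.

Let G := (H <*> <[a]>)%G.

Lemma commute_conj_join h g : h \in H -> g \in G -> commute h (h ^ g).
Proof.
move=> Hh; rewrite /G /= norm_joinEr ?cycle_subG // => /mulsgP[k _ Hk /cyclePmin[i lt_i ->] ->].
have : (i < 3)%N by apply: leq_trans lt_i _; rewrite dvdn_leq // order_dvdn a3.
case: i lt_i => [|[|[|//]]] _ _.
- by rewrite mulg1; exact: commute_conj_sub.
- by apply: commute_conj_coset => //; rewrite mem_rcoset mulgK.
(* Elements of the coset of [a ^+ 2] are inverses of elements of [T]. *)
rewrite -[k * _]invgK; apply: commuteJV; apply: commute_conj_coset => //.
by rewrite expg2 mulgA coset_mulV // ?coset_mull // mem_rcoset ?mulgK ?mulgV.
Qed.

Lemma commute_conj_conj h g g' :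
  h \in H -> g \in G -> g' \in G -> commute (h ^ g) (h ^ g').
Proof.
move=> Hh Gg Gg'; apply/(commuteJ g^-1); rewrite conjgK -conjgM.
by apply: commute_conj_join => //; rewrite groupM ?groupV.
Qed.

(* [h * h ^ (t * w) * h ^ (t * w)^-1] is a quadratic function of [w], so its
   value at 1 is an alternating product of its values at seven generic words. *)
Lemma conj_coset_prod h t : h \in H -> t \in T -> h * h ^ t * h ^ t^-1 = 1.
Proof.
move=> Hh Tt.
have GH w : w \in H -> w \in G by move=> Hw; rewrite mem_gen // inE Hw.
have Ga : a \in G by rewrite mem_gen // inE cycle_id orbT.
have Gt : t \in G by case/rcosetP: Tt => k Hk ->; exact: groupM (GH _ Hk) Ga.
have [] := @ex_good_words (fun w => cube_pair h (t * w)).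
  apply: (@leq_ltn_trans (7 * (3 * bad))); last by lia.
  rewrite leq_mul2l /=; apply: leq_trans (sum_cube_pair Hh).
  apply: (@leq_sum_inj _ _ H T (mulg t) (fun w => ~~ cube_pair h w : nat)).
    by move=> y z _ _ /mulgI.
  by move=> w Hw; exact: coset_mulr.
move=> x [y [z [[Hx Hy Hz] [Px Py Pz] [Pxy Pxz Pyz] Pxyz]]].
pose b w := h ^ (t * w).
have dE w : cube_pair h (t * w) -> h ^ (t * w)^-1 = (h * b w)^-1.
  by case/cube_pairP=> _ _ _ eq1; apply: (mulgI (h * b w)); rewrite mulgV.
have htE : h ^ t = b x * (b (x * z))^-1 * b z
                   * ((b (y * z))^-1 * b (x * y * z) * (b (x * y))^-1) * b y.
  have assoc7 (u1 u2 u3 u4 u5 u6 u7 : gT) :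
      u1 * u2 * u3 * (u4 * u5 * u6) * u7 = u1 * u2 * u3 * u4 * u5 * u6 * u7.
    by rewrite !mulgA.
  rewrite assoc7 [LHS](conj_alternating (commg4 (coset_conj Hh Tt) Hx Hy Hz)).
  by rewrite -!conjgM.
have htVE : h ^ t^-1 = (b x * (b (x * z))^-1 * b z)^-1
    * ((b (y * z))^-1 * b (x * y * z) * (b (x * y))^-1)^-1 * (b y)^-1 * h^-1.
  (* Inverting and reversing [x], [y], [z] makes the same seven words appear, now as [(t * w)^-1],
     so that [dE] applies to each. *)
  have commg4V := commg4 Hh (groupVr Hz) (groupVr Hy) (groupVr Hx).
  have cancel (u1 u2 u3 u4 u5 u6 u7 : gT) :
      (h * u3)^-1 * (h * u2)^-1^-1 * (h * u1)^-1 * (h * u6)^-1^-1 * (h * u5)^-1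
        * (h * u4)^-1^-1 * (h * u7)^-1
      = (u1 * u2^-1 * u3)^-1 * (u4^-1 * u5 * u6^-1)^-1 * u7^-1 * h^-1.
    by rewrite !invMg !invgK !mulgA !mulgKV.
  by rewrite [LHS](conj_alternatingJ _ commg4V) -![in LHS]invMg (mulgA x y z) !dE //.
have cb w w' : w \in H -> w' \in H -> commute (b w) (b w').
  by move=> Hw Hw'; apply: commute_conj_conj => //; apply: groupM Gt (GH _ _).
rewrite htE htVE; set u := b x * _ * _; set v := _^-1 * _ * _.
have Hxy := groupM Hx Hy; have Hxz := groupM Hx Hz; have Hyz := groupM Hy Hz.
have cbu w : w \in H -> commute (b w) u.
  move=> Hw; apply: commuteM (commuteM _ (commuteV _)) _; exact: cb.
have cbv w : w \in H -> commute (b w) v.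
  move=> Hw; apply: commuteM (commuteM (commuteV _) _) (commuteV _); apply: cb => //.
  exact: groupM.
have cuv : commute u v.
  apply: commuteM (commuteM (commuteV _) _) (commuteV _); apply/commute_sym/cbu => //.
  exact: groupM.
have u_vb : (v * b y) * u^-1 = u^-1 * (v * b y).
  by apply/commuteV/commute_sym/commuteM => //; apply/commute_sym/cbu.
have assoc (p q r : gT) : h * (p * q * r) * (p^-1 * q^-1 * r^-1 * h^-1)
                          = h * (p * (q * r * p^-1) * (r * q)^-1 * h^-1).
  by rewrite invMg !mulgA.
by rewrite assoc u_vb mulKVg (cbv y Hy) mulgV mul1g mulgV.
Qed.

(** Write [s = t * h] with [t] of trivial cube; [cube_mulg_conj] then gives the cube of [s] as a
    product of three commuting conjugates of [h], trivial by [conj_coset_prod]. *)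
Lemma coset_cube s : s \in T -> s ^+ 3 = 1.
Proof.
move=> Ts.
have [t Tt /eqP] : exists2 t, t \in T & (t ^+ 3 != 1) = 0 :> nat.
  by apply: ex_sum_eq0; rewrite -/bad card_coset; lia.
rewrite eqb0 negbK => /eqP t3; pose h := t^-1 * s.
have Hh : h \in H by have := coset_conj (coset_div Ts Tt) Tt; rewrite /conjg mulgKV.
rewrite -(mulKVg t s) -/h cube_mulg_conj //.
have -> : h ^ t^-1 = (h * h ^ t)^-1.
  by apply: (mulgI (h * h ^ t)); rewrite mulgV conj_coset_prod.
by rewrite -mulgA -(commute_conj_coset Hh Tt) mulVg.
Qed.

End CubesInCoset.

(** * From automorphisms to cosets of permutations *)

Section RegularRepresentation.

Variables (gT : finGroupType) (phi : {perm gT}).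
Hypotheses (autphi : phi \in Aut [set: gT]) (phi3 : phi ^+ 3 = 1).

(** Permutations compose from left to right, so right translations give a homomorphism. *)
Definition rtrans (x : gT) : {perm gT} := perm (@mulIg gT x).

Lemma rtransE x u : rtrans x u = u * x.
Proof. exact: permE. Qed.

Lemma rtransM : {morph rtrans : x y / x * y}.
Proof. by move=> x y; apply/permP=> u; rewrite permM !rtransE mulgA. Qed.

Lemma rtrans_inj : injective rtrans.
Proof. by move=> x y /permP/(_ 1); rewrite !rtransE !mul1g. Qed.

Lemma rtrans1 : rtrans 1 = 1.
Proof. by apply/permP=> u; rewrite rtransE perm1 mulg1. Qed.

Lemma rtrans_conj x : rtrans x ^ phi = rtrans (phi x).
Proof.
have phiM := morphicP (Aut_morphic autphi).
by apply/permP=> u; rewrite !permM !rtransE phiM ?inE // permKV.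
Qed.

Lemma group_set_rtrans : group_set (rtrans @: [set: gT]).
Proof.
apply/group_setP; split=> [|_ _ /imsetP[x _ ->] /imsetP[y _ ->]].
  by rewrite -rtrans1 imset_f.
by rewrite -rtransM imset_f.
Qed.

(** Moving the factors [phi^-1] to the right conjugates the translations by 1, [phi] and [phi ^+ 2],
    and leaves [phi ^- 3 = 1]. *)
Lemma X3E x : (x \in X3 phi) = ((rtrans x * phi^-1) ^+ 3 == 1).
Proof.
have phiV : phi^-1 = phi * phi by apply: (mulgI phi); rewrite mulgV mulgA -expg3E.
have -> : (rtrans x * phi^-1) ^+ 3 = rtrans (x * phi x * phi (phi x)).
  rewrite !rtransM -!rtrans_conj expg3E /conjg !mulgA mulgK.
  by rewrite -[RHS]mulgA -phiV.
by rewrite inE -rtrans1 (inj_eq rtrans_inj).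
Qed.

Lemma X3_full : (1000 * #|~: X3 phi| < #|[set: gT]|)%N -> X3 phi = [set: gT].
Proof.
move=> lt_n; pose H := Group group_set_rtrans.
have nHphi : phi^-1 \in 'N(H).
  rewrite groupV; apply/normP; apply/eqP; rewrite eqEcard cardJg leqnn andbT.
  by apply/subsetP=> _ /imsetP[_ /imsetP[x _ ->] ->]; rewrite rtrans_conj imset_f.
have phiV3 : phi^-1 ^+ 3 = 1 by rewrite expgVn phi3 invg1.
apply/setP=> x; rewrite in_setT X3E; apply/eqP.
apply: (coset_cube nHphi phiV3); last by rewrite mem_rcoset mulgK imset_f.
rewrite card_imset; last exact: rtrans_inj.
apply: leq_ltn_trans lt_n; rewrite leq_mul2l /=.
have -> : H :* phi^-1 = (fun x => rtrans x * phi^-1) @: [set: gT].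
  by rewrite -rcosetE /rcoset -imset_comp.
rewrite big_imset /= => [|y z _ _ /mulIg/rtrans_inj //].
rewrite -sum1_card [leqRHS]big_mkcond [leqLHS]big_mkcond; apply: leq_sum => y _.
by rewrite in_setT in_setC -X3E; case: (_ \in X3 phi).
Qed.

End RegularRepresentation.

(* c_3 < 1 : the supremum of the ratios different from 1 is bounded by some c < 1 *)
Theorem theorem3p4 :
  exists c : rat, (c < 1)%R /\
    forall (gT : finGroupType) (phi : {perm gT}),
      phi \in Aut [set: gT] -> (phi ^+ 3 = 1)%g ->
      X3ratio phi != 1%R -> (X3ratio phi <= c)%R.
Proof.
(* [k] is opaque because [rat] arithmetic would compute with a unary 999. *)
have [k kE] : exists k, k = 999%N by exists 999%N.
exists (k%:R / k.+1%:R)%R; split; first by rewrite ltr_pdivrMr ?ltr0Sn // mul1r ltr_nat.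
move=> gT phi autphi phi3.
have n_gt0 : (0 < #|[set: gT]|)%N by exact: cardG_gt0.
(* A ratio above 999/1000 leaves fewer than one element in 1000 outside [X3 phi], so [X3_full] makes
   the ratio 1. *)
apply: contraR; rewrite -ltNge /X3ratio => gt_c.
rewrite X3_full ?divff // ?pnatr_eq0 -?lt0n //.
move: gt_c; rewrite ltr_pdivlMr ?ltr0n // mulrAC ltr_pdivrMr ?ltr0Sn //.
rewrite -!natrM ltr_nat => gt_c.
have := cardsC (X3 phi); rewrite -cardsT.
by lia.
Qed.
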